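(* Let $j\in\mathbb{Z}_{\ge 0}$ and $k\in\mathbb{Z}_{>0}$. Then $$\sum_{n=0}^{\infty}\frac{4^n}{(2n+1)^{k+1}\binom{2n}{n}}\,t_{n+1}^{\star}(\{2\}_j)=\frac{2}{(k-1)!}\int_0^1\frac{\ln^{k-1}\!\left(\frac{1+t^2}{2t}\right)\operatorname{Ti}_{2j+1}(t)}{t}\,dt.$$
   Context: For $n\in\mathbb{Z}_{>0}$ and $j\in\mathbb{Z}_{\ge 0}$, $$t_n^{\star}(\{2\}_j):=\sum_{n\ge n_1\ge\cdots\ge n_j\ge 1}\prod_{i=1}^j\frac{1}{(2n_i-1)^2},$$ where the $n_i$ are integers, with the convention $t_n^{\star}(\{2\}_0)=t_n^\star(\emptyset)=1$. For $m\in\mathbb{Z}_{>0}$ the inverse tangent integral is $\operatorname{Ti}_m(x):=\sum_{n=1}^{\infty}\frac{(-1)^{n-1}x^{2n-1}}{(2n-1)^m}$ for $|x|\le 1$ (so $\operatorname{Ti}_1=\arctan$). $\ln^{k-1}(\cdot)$ denotes the $(k-1)$-th power of the natural logarithm. *)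

(* Defs.v *)
From HB Require Import structures.
From mathcomp Require Import all_boot all_order all_algebra.
From mathcomp Require Import all_classical all_reals all_analysis.

Set Implicit Arguments.
Unset Strict Implicit.
Unset Printing Implicit Defensive.

Import Order.TTheory GRing.Theory Num.Theory.
Import numFieldNormedType.Exports.

Local Open Scope classical_set_scope.
Local Open Scope ring_scope.

(* t*_n({2}_j). The tuple s = (n_1, ..., n_j) takes its entries in {0, ..., n};
   the filter keeps n_1 >= ... >= n_j and n_i >= 1.  For j = 0 the only tuple
   is the empty one, so the value is 1. *)
Definition t_star (R : realType) (n j : nat) : R :=
  \sum_(s : j.-tuple 'I_n.+1 |
      sorted geq [seq val i | i <- s] && all (fun i : 'I_n.+1 => 0 < i)%N s)
    \prod_(i <- s) (1 / (2 * i - 1)%:R ^+ 2).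

(* The inverse tangent integral, meaningful for 0 < m and `|x| <= 1; the series
   is the limit of its partial sums (convergence is only conditional when m = 1
   and `|x| = 1). *)
Definition Ti (R : realType) (m : nat) (x : R) : R :=
  \big[+%R/0]_(1 <= n <oo) ((-1) ^+ (n - 1) * x ^+ (2 * n - 1) / (2 * n - 1)%:R ^+ m).

(* Main.v *)
Require Import Defs.
From HB Require Import structures.
From mathcomp Require Import all_boot all_order all_algebra.
From mathcomp Require Import all_classical all_reals all_analysis.
From mathcomp Require Import measurable_realfun.
From mathcomp Require Import ring lra zify.

Set Implicit Arguments.
Unset Strict Implicit.
Unset Printing Implicit Defensive.

Import Order.TTheory GRing.Theory Num.Theory.
Import numFieldNormedType.Exports.

Local Open Scope classical_set_scope.
Local Open Scope ring_scope.

(* With [c n = 4 ^ n / ((2 n + 1) 'C(2 n, n))] and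
   [F x = \sum_n c n * t*_(n+1)({2}_j) * x ^ (2 n + 1)], the recursion of [t*] in [n]
   says that two applications of [sqrt (1 - x ^ 2) * x * d/dx] to
   [sqrt (1 - x ^ 2) * F] lower [j] by one.  Under [x = 2 t / (1 + t ^ 2)] this
   operator is [t * d/dt], which lowers the index of [Ti] by one, whence
   [(1 - t ^ 2) / (1 + t ^ 2) * F x = 2 * Ti_(2 j + 1) t].  Multiply by
   [(- ln x) ^ (k - 1)] and integrate against [dx / x]: all terms are nonnegative,
   so monotone convergence reduces the left-hand side to the moments
   [\int_0^1 (- ln x) ^ (k - 1) x ^ (2 n) dx = (k - 1)! / (2 n + 1) ^ k]. *)

(** * The recursion of the star sums *)

(** The largest index [n_1 = i + 1] is stripped off first, so the denominator [2 n_1 - 1] reads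
    [2 * i + 1] and [n_1] bounds the remaining indices. *)
Fixpoint odd_sum (R : realType) (j n : nat) : R :=
  if j is j'.+1 then \sum_(i < n) odd_sum R j' i.+1 / (2 * i + 1)%:R ^+ 2 else 1.

(** The bound [b] is kept apart from the ambient range [N] for the induction: removing the head of a
    tuple lowers the bound to that head, while the entries stay in ['I_N.+1]. *)
Lemma odd_sum_tuples (R : realType) (N j b : nat) : (b <= N)%N ->
  \sum_(s : j.-tuple 'I_N.+1 |
      path geq b [seq val i | i <- s] && all (fun i : 'I_N.+1 => 0 < i)%N s)
    \prod_(i <- s) (1 / (2 * i - 1)%:R ^+ 2) = odd_sum R j b.
Proof.
elim: j b => [|j IH] b bN.
  rewrite (big_pred1 [tuple]) ?big_nil// => s.
  by rewrite [s]tuple0 /= eqxx.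
rewrite (reindex (fun p : 'I_N.+1 * j.-tuple 'I_N.+1 => cons_tuple p.1 p.2)); last first.
  exists (fun s : j.+1.-tuple 'I_N.+1 => (thead s, [tuple of behead s])) => [[x s] _|s _] /=.
    by congr pair; apply/val_inj.
  by rewrite [RHS]tuple_eta; apply/val_inj.
pose P (i : 'I_N.+1) := (0 < i <= b)%N.
pose Q (i : 'I_N.+1) (s : j.-tuple 'I_N.+1) :=
  path geq i [seq val k | k <- s] && all (fun k : 'I_N.+1 => 0 < k)%N s.
rewrite (eq_bigl (fun p => P p.1 && Q p.1 p.2)); last first.
  by move=> [x s]; rewrite /P /Q /= andbACA [(x <= b)%N && _]andbC.
under eq_bigr do rewrite big_cons.
rewrite -(pair_big_dep P Q (fun i s =>
  1 / (2 * i - 1)%:R ^+ 2 * \prod_(k <- s) (1 / (2 * k - 1)%:R ^+ 2))) /=.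
rewrite (eq_bigr (fun i : 'I_N.+1 => 1 / (2 * i - 1)%:R ^+ 2 * odd_sum R j i)); last first.
  by move=> i _; rewrite -mulr_sumr IH// -ltnS.
(* The index 0 fails [P], and the others are shifted by one to match [odd_sum]. *)
rewrite big_mkcond big_ord_recl /= add0r.
rewrite [RHS](big_ord_widen N (fun i => odd_sum R j i.+1 / (2 * i + 1)%:R ^+ 2)) //.
rewrite [RHS]big_mkcond; apply: eq_bigr => i _; rewrite /P /bump /= add1n.
case: ifP => // _; rewrite mulrC div1r; congr (_ / _%:R ^+ 2).
lia.
Qed.

Lemma t_starE (R : realType) (n j : nat) : t_star R n j = odd_sum R j n.
Proof.
rewrite -(@odd_sum_tuples R n j n)//; apply: eq_bigl => s; congr (_ && _).
case: s => -[|x s] //= _.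
by rewrite -[(x <= n)%N]ltnS ltn_ord.
Qed.

Lemma odd_sum_ge0 (R : realType) (j n : nat) : 0 <= odd_sum R j n.
Proof.
by elim: j n => [|j IH] n //=; apply: sumr_ge0 => i _; rewrite divr_ge0// exprn_ge0.
Qed.

Lemma odd_sum_le (R : realType) (j n : nat) : odd_sum R j n <= 2 ^+ j.
Proof.
elim: j n => [|j IH] n //=.
(* A telescoping majorant: with [x = 2 n + 1] its increment is [3 / (x * (x + 2))], which is at
   least [1 / x ^ 2] exactly when [x >= 1]. *)
suff H : \sum_(i < n) ((2 * i + 1)%:R ^+ 2)^-1 <= 3 / 2 - (3 / 2) / (2 * n + 1)%:R :> R.
  apply: (@le_trans _ _ (\sum_(i < n) 2 ^+ j * ((2 * i + 1)%:R ^+ 2)^-1)).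
    by apply: ler_sum => i _; rewrite ler_wpM2r// invr_ge0 exprn_ge0.
  rewrite -big_distrr exprSr ler_wpM2l ?exprn_ge0//= (le_trans H)//.
  have : 0 <= (3 / 2) / (2 * n + 1)%:R :> R by rewrite divr_ge0//; lra.
  by lra.
elim: n => [|n IHn]; first by rewrite big_ord0 muln0 divr1 subrr.
rewrite big_ord_recr /=; apply: (le_trans (lerD IHn (lexx _))).
have -> : (2 * n.+1 + 1)%:R = 2 + (2 * n + 1)%:R :> R by rewrite mulnS -addnA natrD.
set x := (2 * n + 1)%:R.
have x1 : 1 <= x :> R by rewrite ler1n addn1.
rewrite -addrA lerD2l -subr_ge0.
have -> : - (3 / 2 / (2 + x)) - (- (3 / 2 / x) + (x ^+ 2)^-1) =
    (2 * (x - 1)) / (x ^+ 2 * (2 + x)) :> R.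
  by field; apply/andP; split; apply/eqP; lra.
by rewrite divr_ge0// mulr_ge0//; [lra | exact: exprn_ge0 | lra].
Qed.

(** * Power series of radius at least one *)

Section Derivatives.
Context {R : realType}.
Implicit Types (f g : R -> R) (x df dg : R).

Lemma is_derive_addf f g x df dg : is_derive x 1 f df -> is_derive x 1 g dg ->
  is_derive x 1 (fun y => f y + g y) (df + dg).
Proof. exact: is_deriveD. Qed.

Lemma is_derive_mulf f g x df dg : is_derive x 1 f df -> is_derive x 1 g dg ->
  is_derive x 1 (fun y => f y * g y) (f x * dg + g x * df).
Proof. exact: is_deriveM. Qed.

Lemma is_derive_expf f n x df : is_derive x 1 f df ->
  is_derive x 1 (fun y => f y ^+ n) (n%:R * f x ^+ n.-1 * df).
Proof.
move=> H; have <- : f ^+ n = (fun y => f y ^+ n) by apply/funext => y; rewrite exprfctE.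
by apply: is_derive_eq; rewrite mulr_natl.
Qed.

Lemma is_derive_invf f x df : f x != 0 -> is_derive x 1 f df ->
  is_derive x 1 (fun y => (f y)^-1) (- df / f x ^+ 2).
Proof.
move=> fx0 H; apply: is_derive_eq (is_deriveV fx0 H) _.
by rewrite scaleNr mulNr mulrC.
Qed.

Lemma is_derive_compf f g x df dg : is_derive x 1 f df -> is_derive (f x) 1 g dg ->
  is_derive x 1 (fun y => g (f y)) (dg * df).
Proof. move=> Hf Hg; exact: is_derive1_comp. Qed.

End Derivatives.

(** * Uniqueness for the operator [1 + 2 v d/dv] on [[0, 1)] *)

Section EulerOperator.
Context {R : realType}.

(* [h + 2 v h'] at [v = t ^ 2] is the derivative of [t h(t ^ 2)]. *)
Lemma euler_eq0 (h dh : R -> R) :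
  (forall v : R, 0 <= v < 1 -> is_derive v 1 h (dh v)) ->
  (forall v : R, 0 <= v < 1 -> h v + 2 * v * dh v = 0) ->
  forall v : R, 0 <= v < 1 -> h v = 0.
Proof.
move=> Dh h0 v /andP[]; rewrite le_eqVlt => /predU1P[<- _|v0 v1].
  (* At [v = 0] the equation itself reads [h 0 = 0]. *)
  by have := h0 0; rewrite mulr0 mul0r addr0; apply; rewrite lexx ltr01.
pose k (t : R) := t * h (t ^+ 2).
have Dk (t : R) : 0 <= t < 1 -> is_derive t 1 k 0.
  move=> /andP[t0 t1].
  have t2 : 0 <= t ^+ 2 < 1 by rewrite exprn_ge0// exprn_ilt1.
  apply: (is_derive_eq (is_derive_mulf (is_derive_id _ _)
    (is_derive_compf (is_derive_expf 2 (is_derive_id _ _)) (Dh _ t2)))).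
  by rewrite -[RHS](h0 _ t2) /=; ring.
set t := Num.sqrt v.
have t0 : 0 < t by rewrite sqrtr_gt0.
have tv : t ^+ 2 = v by rewrite sqr_sqrtr// ltW.
have t1 : t < 1 by rewrite -(@ltr_pXn2r _ 2) ?nnegrE// ?ltW// tv expr1n.
have Dk' x : x \in `]0, t[%R -> is_derive x 1 k ((cst 0 : R -> R) x).
  by rewrite in_itv/= => /andP[x0 xt]; apply: Dk; rewrite ltW//= (lt_trans xt).
have Ck : {within `[0, t], continuous k}.
  apply: derivable_within_continuous => x; rewrite in_itv/= => /andP[x0 xt].
  by have /Dk[] : 0 <= x < 1 by rewrite x0 (le_lt_trans xt).
(* Since [k] has zero derivative and [k 0 = 0], this yields [t * h v = 0] with [t > 0]. *)
have [c _] := MVT t0 Dk' Ck.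
rewrite /k mul0r subr0 mul0r tv => /eqP; rewrite mulf_eq0 gt_eqF//= => /eqP.
by [].
Qed.

(** Regularity at 0 replaces an initial condition: the homogeneous solutions are the multiples of
    [v ^ (- 1 / 2)], which are singular there. *)
Lemma euler_inj (h dh g dg : R -> R) :
  (forall v : R, 0 <= v < 1 -> is_derive v 1 h (dh v)) ->
  (forall v : R, 0 <= v < 1 -> is_derive v 1 g (dg v)) ->
  (forall v : R, 0 <= v < 1 -> h v + 2 * v * dh v = g v + 2 * v * dg v) ->
  forall v : R, 0 <= v < 1 -> h v = g v.
Proof.
move=> Dh Dg E v v01; apply/eqP; rewrite -subr_eq0; apply/eqP.
apply: (@euler_eq0 (fun v => h v - g v) (fun v => dh v - dg v)) => // {v v01} v v01.
  exact: is_deriveB (Dh _ v01) (Dg _ v01).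
by have := E _ v01; rewrite mulrBr; lra.
Qed.

End EulerOperator.

(** * Coefficient calculus for power series on the unit disc *)

Section PowerSeries.
Context {R : realType}.
Implicit Types (c d : R^nat) (x : R).

Definition psum c x : R := limn (pseries c x).

(** Radius of convergence at least one, phrased by bounded terms because plain estimates carry this
    form over to sums, shifts and derivatives. *)
Definition unit_radius c := forall r, 0 <= r < 1 -> exists C, forall n, `|c n| * r ^+ n <= C.

Definition shift_coef c : R^nat := fun n => if n is n'.+1 then c n' else 0.

Lemma bounded_unit_radius c C : (forall n, `|c n| <= C) -> unit_radius c.
Proof.
move=> cC r /andP[r0 r1]; exists C => n; apply: le_trans (cC n).
by rewrite ler_piMr// exprn_ile1// ltW.
Qed.

Lemma unit_radiusD c d : unit_radius c -> unit_radius d -> unit_radius (fun n => c n + d n).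
Proof.
move=> Hc Hd r r01; have [C HC] := Hc r r01; have [D HD] := Hd r r01.
exists (C + D) => n; apply: le_trans (lerD (HC n) (HD n)).
by rewrite -mulrDl ler_wpM2r ?ler_normD// exprn_ge0//; case/andP: r01.
Qed.

Lemma unit_radiusZ k c : unit_radius c -> unit_radius (fun n => k * c n).
Proof.
move=> Hc r r01; have [C HC] := Hc r r01.
by exists (`|k| * C) => n; rewrite normrM -mulrA ler_wpM2l.
Qed.

Lemma unit_radius_shift c : unit_radius c -> unit_radius (shift_coef c).
Proof.
move=> Hc r r01; have [C HC] := Hc r r01; have /andP[r0 r1] := r01.
have C0 : 0 <= C by apply: le_trans (HC 0%N); rewrite mulr_ge0// exprn_ge0.
exists C => -[|n] /=; first by rewrite normr0 mul0r.
by rewrite exprSr mulrA; apply: le_trans (HC n); rewrite ler_piMr ?(ltW r1)// mulr_ge0// exprn_ge0.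
Qed.

(** Each of the [n.+1] copies of [q ^+ n] is at most the matching term [q ^+ i] of a partial
    geometric sum. *)
Lemma succ_mul_expr_le (q : R) n : 0 <= q < 1 -> n.+1%:R * q ^+ n <= (1 - q)^-1.
Proof.
move=> /andP[q0 q1]; have q1' : 0 < 1 - q by rewrite subr_gt0.
apply: (@le_trans _ _ (\sum_(i < n.+1) q ^+ i)).
  rewrite mulr_natl -[X in _ *+ X]card_ord -sumr_const; apply: ler_sum => i _.
  by apply: ler_wiXn2l => //; [exact: ltW | rewrite -ltnS].
rewrite -(ler_pM2l q1') mulfV ?gt_eqF//.
have -> : (1 - q) * (\sum_(i < n.+1) q ^+ i) = 1 - q ^+ n.+1.
  by rewrite -opprB mulNr -subrX1 opprB.
by rewrite gerBl exprn_ge0.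
Qed.

(** A radius [s] strictly between [r] and 1 leaves a factor [(r / s) ^+ n], which absorbs the [n.+1]
    produced by differentiation. *)
Lemma unit_radius_diffs c : unit_radius c -> unit_radius (pseries_diffs c).
Proof.
move=> Hc r /andP[r0 r1].
have [s [s0 s1 rs]] : exists s : R, [/\ 0 < s, s < 1 & r < s].
  by exists ((1 + r) / 2); split; lra.
have [C HC] : exists C, forall n, `|c n| * s ^+ n <= C by apply: Hc; rewrite ltW.
have q01 : 0 <= r / s < 1.
  by rewrite divr_ge0 ?(ltW s0)//= ltr_pdivrMr// mul1r.
exists (C / s * (1 - r / s)^-1) => n.
rewrite /pseries_diffs normrM normr_nat.
have -> : n.+1%:R * `|c n.+1| * r ^+ n =
    (`|c n.+1| * s ^+ n.+1) / s * (n.+1%:R * (r / s) ^+ n).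
  rewrite expr_div_n exprS; field.
  by rewrite expf_neq0 ?gt_eqF.
apply: ler_pM.
- by rewrite divr_ge0 ?(ltW s0)// mulr_ge0// exprn_ge0// ltW.
- by rewrite mulr_ge0// exprn_ge0//; case/andP: q01.
- by rewrite ler_wpM2r// invr_ge0 ltW.
- exact: succ_mul_expr_le.
Qed.

Lemma is_cvg_psum c x : unit_radius c -> `|x| < 1 -> cvgn (pseries c x).
Proof.
move=> Hc x1; have x0 : 0 <= `|x| by [].
have [s [s0 s1 xs]] : exists s : R, [/\ 0 < s, s < 1 & `|x| < s].
  by exists ((1 + `|x|) / 2); split; lra.
have [C HC] : exists C, forall n, `|c n| * s ^+ n <= C by apply: Hc; rewrite ltW.
have q01 : 0 <= `|x| / s < 1.
  by rewrite divr_ge0 ?(ltW s0)//= ltr_pdivrMr// mul1r.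
apply: normed_cvg.
apply: (@series_le_cvg _ _ (geometric C (`|x| / s))) => [n|n|n|].
- exact: normr_ge0.
- apply: geometric_ge0 => //; last by case/andP: q01.
  by apply: le_trans (HC 0%N); rewrite mulr_ge0// exprn_ge0// ltW.
- rewrite /= normrM normrX expr_div_n mulrA ler_pdivlMr ?exprn_gt0//.
  rewrite mulrAC ler_wpM2r// exprn_ge0//.
- by apply: is_cvg_geometric_series; case/andP: q01 => ? ?; rewrite ger0_norm.
Qed.

Lemma psumD c d x : unit_radius c -> unit_radius d -> `|x| < 1 ->
  psum (fun n => c n + d n) x = psum c x + psum d x.
Proof.
move=> Hc Hd x1; rewrite /psum -limD; try exact: is_cvg_psum.
rewrite /pseries -seriesD; congr (limn (series _)); apply/funext => i.
by rewrite /= mulrDl.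
Qed.

Lemma psumZ k c x : unit_radius c -> `|x| < 1 -> psum (fun n => k * c n) x = k * psum c x.
Proof.
move=> Hc x1; rewrite -[RHS]lim_seriesZ; last exact: is_cvg_psum.
congr (limn (series _)); apply/funext => i.
by rewrite /= -mulrA.
Qed.

Lemma psum_shift c x : unit_radius c -> `|x| < 1 -> psum (shift_coef c) x = x * psum c x.
Proof.
move=> Hc x1; rewrite /psum; apply/cvg_lim => //; rewrite -cvg_shiftS /=.
have -> : (fun n => pseries (shift_coef c) x n.+1) = x \*: pseries c x.
  apply/funext => n; rewrite /pseries /series /= big_nat_recl//= mul0r add0r scaler_sumr.
  by apply: eq_bigr => i _; rewrite exprS mulrCA.
by apply: cvgZl_tmp; exact: is_cvg_psum.
Qed.

Lemma is_derive_psum c x : unit_radius c -> `|x| < 1 ->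
  is_derive x 1 (psum c) (psum (pseries_diffs c) x).
Proof.
move=> Hc x1; pose s := (1 + `|x|) / 2.
have x0 : 0 <= `|x| by [].
have s1 : `|s| < 1 by rewrite ger0_norm /s; lra.
apply: (@pseries_snd_diffs _ _ s).
- exact: is_cvg_psum.
- by apply: is_cvg_psum => //; exact: unit_radius_diffs.
- by apply: is_cvg_psum => //; do 2 apply: unit_radius_diffs.
- by rewrite [ltRHS]ger0_norm /s; lra.
Qed.

(** The operator [f + 2 x f'] on coefficients, that is, [t * d/dt] acting on [t * f (t ^ 2)]. *)
Definition euler_coef c : R^nat := fun n => (2 * n + 1)%:R * c n.

Lemma euler_coefE c : euler_coef c = (fun n => c n + 2 * shift_coef (pseries_diffs c) n).
Proof.
apply/funext => -[|n]; rewrite /euler_coef /= /pseries_diffs; first by rewrite mul1r mulr0 addr0.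
by rewrite natrD natrM; ring.
Qed.

Lemma unit_radius_euler c : unit_radius c -> unit_radius (euler_coef c).
Proof.
move=> Hc; rewrite euler_coefE; apply: unit_radiusD => //.
by apply: unit_radiusZ; apply: unit_radius_shift; apply: unit_radius_diffs.
Qed.

Lemma psum_euler c x : unit_radius c -> `|x| < 1 ->
  psum (euler_coef c) x = psum c x + 2 * x * psum (pseries_diffs c) x.
Proof.
move=> Hc x1; have Hd := unit_radius_diffs Hc.
rewrite euler_coefE psumD// ?psumZ// ?psum_shift ?mulrA//.
  exact: unit_radius_shift.
by apply: unit_radiusZ; exact: unit_radius_shift.
Qed.

End PowerSeries.

(** * The generating function of the star sums *)

Section CentralBinomial.
Context {R : realType}.

(** These are the coefficients of [x ^ (2 n + 1)] in [arcsin x / sqrt (1 - x ^ 2)]. *)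
Definition central_coef (n : nat) : R := 4 ^+ n / ((2 * n + 1)%:R * 'C(2 * n, n)%:R).

Lemma central_binS n : (n.+1 * 'C(2 * n.+1, n.+1) = 2 * (2 * n + 1) * 'C(2 * n, n))%N.
Proof.
have e1 := mul_bin_diag (2 * n + 1).+1 n; have e2 := mul_bin_down (2 * n + 1) n.
have E : ((2 * n + 1).-1 = 2 * n)%N by lia.
have E' : (2 * n + 1 - n = n.+1)%N by lia.
have E'' : (2 * n.+1 = (2 * n + 1).+1)%N by lia.
rewrite E E' in e2; rewrite E'' -e1 /=; nia.
Qed.

Lemma central_coefS n :
  (2 * n.+1 + 1)%:R * central_coef n.+1 = (2 * n.+1)%:R * central_coef n.
Proof.
have b0 m : 'C(2 * m, m)%:R != 0 :> R by rewrite pnatr_eq0 -lt0n bin_gt0; lia.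
have x0 m : (2 * m + 1)%:R != 0 :> R by rewrite pnatr_eq0 addn1.
have n0 : n.+1%:R != 0 :> R by rewrite pnatr_eq0.
have E : n.+1%:R * 'C(2 * n.+1, n.+1)%:R = 2 * (2 * n + 1)%:R * 'C(2 * n, n)%:R :> R.
  by rewrite -!natrM central_binS.
rewrite /central_coef invfM mulrCA mulVKf// -['C(2 * n.+1, n.+1)%:R](mulKf n0) E.
rewrite exprS [(2 * n.+1)%:R]natrM.
move: (b0 n) (x0 n) n0; move: (2 * n + 1)%:R n.+1%:R ('C(_, _)%:R) => x y b b0' x0' y0.
by field; rewrite b0' x0' y0.
Qed.

Lemma central_coef0 : central_coef 0 = 1.
Proof. by rewrite /central_coef muln0 bin0 expr0 mulr1 divr1. Qed.

Lemma central_coef_ge0 n : 0 <= central_coef n.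
Proof. by rewrite divr_ge0// ?exprn_ge0// mulr_ge0. Qed.

(** The recurrence in difference form gives the monotonicity of [central_coef] and, later, the
    telescoping majorant that makes the left-hand series converge. *)
Lemma central_coef_diff n :
  central_coef n - central_coef n.+1 = central_coef n.+1 / (2 * n.+1)%:R.
Proof.
have n0 : (2 * n.+1)%:R != 0 :> R by rewrite pnatr_eq0.
apply: (mulfI n0); rewrite mulrBr -central_coefS [RHS]mulrC divfK// natrD.
by ring.
Qed.

Lemma central_coef_le1 n : central_coef n <= 1.
Proof.
elim: n => [|n IH]; first by rewrite central_coef0.
apply: le_trans IH; rewrite -subr_ge0 central_coef_diff.
by rewrite divr_ge0// central_coef_ge0.
Qed.

End CentralBinomial.

(** * From the generating function of the star sums to [Ti] *)

Section KeyIdentity.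
Context {R : realType}.

Definition star_coef (j n : nat) : R := central_coef n * odd_sum R j n.+1.

(** One of the two applications that lower [j]: if [f] and [g] are the series of [star_coef j] and
    of this sequence, then [sqrt (1 - x ^ 2) * x * d/dx] sends [sqrt (1 - x ^ 2) * x * f (x ^ 2)] to
    [x * g (x ^ 2)]. *)
Definition star_coef_half (j n : nat) : R :=
  euler_coef (star_coef j) n - shift_coef (fun i => euler_coef (star_coef j) i + star_coef j i) n.

Definition Ti_coef (m n : nat) : R := (-1) ^+ n / (2 * n + 1)%:R ^+ m.

Lemma star_coef_ge0 j n : 0 <= star_coef j n.
Proof. by rewrite mulr_ge0// ?central_coef_ge0// odd_sum_ge0. Qed.

(** The coefficient form of [sqrt (1 - x ^ 2) * arcsin' x = 1]; it starts the induction on [j]. *)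
Lemma star_coef_half0 n : star_coef_half 0 n = (n == 0)%N%:R.
Proof.
rewrite /star_coef_half /star_coef /euler_coef /=; case: n => [|n] /=.
  by rewrite central_coef0 subr0 !mulr1.
have E : (2 * n.+1)%:R = (2 * n + 1)%:R + 1 :> R by rewrite natr1; congr _%:R; lia.
by rewrite !mulr1 central_coefS E mulrDl mul1r subrr.
Qed.

(** By [central_coefS] the two terms of [star_coef_half] carry the same prefactor, so only the last
    summand of [odd_sum] survives. Its denominator [(2 n + 1) ^ 2] is cancelled by that prefactor
    and by [euler_coef]. *)
Lemma euler_star_coef_half j : euler_coef (star_coef_half j.+1) = star_coef j.
Proof.
apply/funext => n; have x0 : (2 * n + 1)%:R != 0 :> R by rewrite pnatr_eq0 addn1.
have E : star_coef_half j.+1 n = (2 * n + 1)%:R * central_coef n *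
    (odd_sum R j n.+1 / (2 * n + 1)%:R ^+ 2).
  rewrite /star_coef_half /star_coef /euler_coef; case: n x0 => [|n] x0.
    by rewrite /= big_ord1 subr0 mulrA.
  have E : (2 * n.+1)%:R = (2 * n + 1)%:R + 1 :> R by rewrite natr1; congr _%:R; lia.
  have -> : shift_coef (fun i => (2 * i + 1)%:R * (central_coef i * odd_sum R j.+1 i.+1) +
      central_coef i * odd_sum R j.+1 i.+1) n.+1 =
      (2 * n.+1)%:R * central_coef n * odd_sum R j.+1 n.+1 by rewrite E /shift_coef; ring.
  rewrite mulrA central_coefS -mulrBr; congr (_ * _).
  by rewrite [odd_sum R j.+1 n.+2]big_ord_recr addrAC subrr add0r.
by rewrite /euler_coef E /star_coef; field.
Qed.

Lemma unit_radius_star j : unit_radius (star_coef j).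
Proof.
apply: (@bounded_unit_radius _ _ (2 ^+ j)) => n.
rewrite ger0_norm ?star_coef_ge0// -[leRHS]mul1r.
by apply: ler_pM; rewrite ?central_coef_ge0 ?odd_sum_ge0 ?central_coef_le1 ?odd_sum_le.
Qed.

Lemma unit_radius_star_half j : unit_radius (star_coef_half j).
Proof.
have -> : star_coef_half j = fun n => euler_coef (star_coef j) n +
    -1 * shift_coef (fun i => euler_coef (star_coef j) i + star_coef j i) n.
  by apply/funext => n; rewrite mulN1r.
have Hs := unit_radius_star j; have He := unit_radius_euler Hs.
apply: unit_radiusD => //; apply: unit_radiusZ; apply: unit_radius_shift.
exact: unit_radiusD.
Qed.

Lemma psum_star_half j (w : R) : `|w| < 1 -> psum (star_coef_half j) w =
  psum (euler_coef (star_coef j)) w - w * (psum (euler_coef (star_coef j)) w + psum (star_coef j) w).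
Proof.
move=> w1; have Hs := unit_radius_star j; have He := unit_radius_euler Hs.
have -> : star_coef_half j = fun n => euler_coef (star_coef j) n +
    -1 * shift_coef (fun i => euler_coef (star_coef j) i + star_coef j i) n.
  by apply/funext => n; rewrite mulN1r.
have Hd := unit_radiusD He Hs; have Hh := unit_radius_shift Hd.
by rewrite psumD ?psumZ ?psum_shift ?psumD ?mulN1r//; exact: unit_radiusZ.
Qed.

Lemma unit_radius_Ti m : unit_radius (Ti_coef m).
Proof.
apply: (@bounded_unit_radius _ _ 1) => n.
rewrite normrM normrX normrN1 expr1n mul1r ger0_norm ?invr_ge0 ?exprn_ge0//.
by rewrite invf_le1 ?exprn_gt0 ?ltr0n ?addn1// exprn_ege1// ler1n.
Qed.

Lemma euler_Ti_coef m : euler_coef (Ti_coef m.+1) = Ti_coef m.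
Proof.
apply/funext => n; rewrite /euler_coef /Ti_coef exprS.
have : (2 * n + 1)%:R != 0 :> R by rewrite pnatr_eq0 addn1.
by move: (2 * n + 1)%:R => x x0; field; rewrite expf_neq0.
Qed.

Lemma psum_Ti0 (v : R) : `|v| < 1 -> psum (Ti_coef 0) v = (1 + v)^-1.
Proof.
move=> v1; rewrite /psum; apply/cvg_lim => //.
have -> : pseries (Ti_coef 0) v = series (geometric 1 (- v)).
  rewrite /pseries; congr series; apply/funext => n.
  by rewrite /Ti_coef /= expr0 divr1 mul1r -exprNn.
by have := @cvg_geometric_series R 1 (- v); rewrite normrN opprK div1r; apply.
Qed.

Let w (v : R) := 4 * v / (1 + v) ^+ 2.

(** With [v = t ^ 2] and [x = 2 t / (1 + v)] one has [w v = x ^ 2] and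
    [sqrt (1 - x ^ 2) = (1 - v) / (1 + v)], so this is [sqrt (1 - x ^ 2) * F x / (2 t)]. *)
Let G j (v : R) := (1 - v) / (1 + v) ^+ 2 * psum (star_coef j) (w v).

Let w_lt1 (v : R) : 0 <= v < 1 -> `|w v| < 1.
Proof.
move=> /andP[v0 v1]; rewrite ger0_norm; last by rewrite divr_ge0 ?exprn_ge0//; lra.
rewrite ltr_pdivrMr ?exprn_gt0; [|lra..].
rewrite mul1r -subr_gt0; have -> : (1 + v) ^+ 2 - 4 * v = (1 - v) ^+ 2 by ring.
by rewrite exprn_gt0// subr_gt0.
Qed.

Let is_derive_w (v : R) : 0 <= v < 1 -> is_derive v 1 w (4 * (1 - v) / (1 + v) ^+ 3).
Proof.
move=> /andP[v0 v1]; have v1' : 1 + v != 0 by apply/eqP; lra.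
apply: (is_derive_eq (is_derive_mulf
  (is_derive_mulf (is_derive_cst (4 : R) _ _) (is_derive_id _ _))
  (is_derive_invf _ (is_derive_expf 2 (is_derive_addf (is_derive_cst (1 : R) _ _) (is_derive_id _ _)))))).
  by rewrite expf_neq0.
by rewrite /=; field.
Qed.

(* For [x = 2 t / (1 + t ^ 2)], [t d/dt] is [sqrt (1 - x ^ 2) x d/dx]. With
   [v = t ^ 2] it becomes [1 + 2 v d/dv] once the prefactor [t] is removed. *)
Lemma psum_star_Ti (j : nat) (v : R) : 0 <= v < 1 ->
  (1 - v) / (1 + v) ^+ 2 * psum (star_coef j) (4 * v / (1 + v) ^+ 2) =
  psum (Ti_coef (2 * j + 1)) v.
Proof.
have cst_id (y : R) : is_derive y 1 (fun z => 1 + z) (0 + 1).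
  exact: is_derive_addf (is_derive_cst (1 : R) _ _) (is_derive_id _ _).
have cst_Nid (y : R) : is_derive y 1 (fun z => 1 - z) (0 - 1).
  exact: is_deriveB (is_derive_cst (1 : R) _ _) (is_derive_id _ _).
have nz (y : R) : 0 <= y < 1 -> 1 + y != 0 by move=> /andP[y0 y1]; apply/eqP; lra.
have dTi m (y : R) : 0 <= y < 1 ->
    is_derive y 1 (psum (Ti_coef m)) (psum (pseries_diffs (Ti_coef m)) y).
  by move=> /andP[y0 y1]; apply: is_derive_psum; [exact: unit_radius_Ti|rewrite ger0_norm].
have eTi m (y : R) : 0 <= y < 1 -> psum (Ti_coef m.+1) y +
    2 * y * psum (pseries_diffs (Ti_coef m.+1)) y = psum (Ti_coef m) y.
  move=> /andP[y0 y1]; rewrite -psum_euler ?euler_Ti_coef ?ger0_norm//.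
  exact: unit_radius_Ti.
(* [step1] and [step2] alternate, each inverting the Euler operator once and raising the index of
   [Ti_coef] by one: from [2 i] to [2 i + 1], then to [2 i + 2]. *)
have step1 i : (forall y : R, 0 <= y < 1 ->
      psum (star_coef_half i) (w y) / (1 + y) = psum (Ti_coef (2 * i)) y) ->
    forall y, 0 <= y < 1 -> G i y = psum (Ti_coef (2 * i).+1) y.
  move=> H; apply: (@euler_inj _ _ (fun y : R => (y - 3) / (1 + y) ^+ 3 * psum (star_coef i) (w y) +
     (1 - y) / (1 + y) ^+ 2 * (psum (pseries_diffs (star_coef i)) (w y) * (4 * (1 - y) / (1 + y) ^+ 3)))
     _ (psum (pseries_diffs (Ti_coef (2 * i).+1)))) => y y01.
  - have := is_derive_mulf (is_derive_mulf (cst_Nid y)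
        (@is_derive_invf _ (fun z => (1 + z) ^+ 2) _ _ (expf_neq0 2 (nz y y01)) (is_derive_expf 2 (cst_id y))))
      (is_derive_compf (is_derive_w y01) (is_derive_psum (unit_radius_star i) (w_lt1 y01))).
    move/is_derive_eq; apply => /=; have y0 := nz y y01.
    by move: (psum _ _) (psum _ _) => A B; field.
  - rewrite eTi// -H// psum_star_half ?psum_euler ?w_lt1//; last exact: unit_radius_star.
    rewrite /G /w; have y0 := nz y y01.
    by move: (psum _ _) (psum _ _) => A B; field.
have step2 i : (forall y, 0 <= y < 1 -> G i y = psum (Ti_coef (2 * i).+1) y) ->
    forall y : R, 0 <= y < 1 ->
      psum (star_coef_half i.+1) (w y) / (1 + y) = psum (Ti_coef (2 * i.+1)) y.
  move=> H; have -> : (2 * i.+1 = (2 * i).+2)%N by lia.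
  apply: (@euler_inj _ (fun y => psum (star_coef_half i.+1) (w y) / (1 + y))
     (fun y : R => - psum (star_coef_half i.+1) (w y) / (1 + y) ^+ 2 +
     psum (pseries_diffs (star_coef_half i.+1)) (w y) * (4 * (1 - y) / (1 + y) ^+ 3) / (1 + y))
     (psum (Ti_coef (2 * i).+2)) (psum (pseries_diffs (Ti_coef (2 * i).+2)))) => y y01.
  - have := is_derive_mulf
      (is_derive_compf (is_derive_w y01) (is_derive_psum (unit_radius_star_half i.+1) (w_lt1 y01)))
      (@is_derive_invf _ (fun z => 1 + z) _ _ (nz y y01) (cst_id y)).
    move/is_derive_eq; apply => /=; have y0 := nz y y01.
    by move: (psum _ _) (psum _ _) => A B; field.
  - rewrite eTi// -H// /G -euler_star_coef_half psum_euler ?w_lt1//; last exact: unit_radius_star_half.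
    rewrite /w; have y0 := nz y y01.
    by move: (psum _ _) (psum _ _) => A B; field.
suff H i : forall y : R, 0 <= y < 1 ->
    psum (star_coef_half i) (w y) / (1 + y) = psum (Ti_coef (2 * i)) y.
  by move=> v01; rewrite addn1; apply: (step1 j (H j)).
elim: i => [|i IH]; last exact: step2 (step1 _ IH).
move=> y /andP[y0 y1]; rewrite muln0 psum_Ti0 ?ger0_norm//.
(* For [i = 0] the half-step series is the constant 1, and both sides equal [1 / (1 + y)]. *)
rewrite [psum _ _](_ : _ = 1) ?div1r// /psum; apply/cvg_lim => //.
rewrite -cvg_shiftS; apply: cvg_near_cst; apply: nearW => n /=.
rewrite /pseries /series /= big_nat_recl//= star_coef_half0 mulr1 big1 ?addr0//.
by move=> m _; rewrite star_coef_half0 mul0r.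
Qed.

End KeyIdentity.

(** * Logarithmic moments *)

Section LogMoments.
Context {R : realType}.
Local Notation mu := (@lebesgue_measure R).

Lemma measurable_itvoo01 (f : R -> R) :
  (forall t : R, 0 < t -> {for t, continuous f}) -> measurable_fun (`]0, 1[%classic : set R) f.
Proof.
move=> Cf; apply: open_continuous_measurable_fun => //.
by move=> t; rewrite inE/= in_itv/= => /andP[t0 _]; exact: Cf.
Qed.

(** An improper integral at 0: []0, 1]] is exhausted by the intervals [[expR (- n.+1), 1]], and
    nonnegativity of [f] allows monotone convergence. Exponential endpoints suit the logarithm in
    the application. *)
Lemma integral_itvoo_FTC (f F : R -> R) :
  (forall t : R, 0 < t -> is_derive t 1 F (f t)) ->
  (forall t : R, 0 < t -> {for t, continuous f}) ->
  (forall t : R, 0 < t <= 1 -> 0 <= f t) ->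
  F (expR (- n%:R)) @[n --> \oo] --> 0 ->
  (\int[mu]_(t in `]0%R, 1%R[) (f t)%:E = (F 1)%:E)%E.
Proof.
move=> DF Cf f0 F0; pose e n : R := expR (- n.+1%:R).
have e0 n : 0 < e n by exact: expR_gt0.
have e1 n : e n < 1 by rewrite /e expR_lt1 oppr_lt0.
have CF (t : R) : 0 < t -> F x @[x --> t] --> F t.
  by move=> /DF[dF _]; apply: differentiable_continuous; exact/derivable1_diffP.
have Ie n : (\int[mu]_(t in `[e n, 1%R]) (f t)%:E = (F 1)%:E - (F (e n))%:E)%E.
  apply: continuous_FTC2 => //.
  - apply: continuous_in_subspaceT => t; rewrite inE/= in_itv/= => /andP[et _].
    exact/Cf/lt_le_trans/et.
  - split.
    + by move=> t; rewrite in_itv/= => /andP[et _]; have [] := DF t (lt_trans (e0 n) et).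
    + by apply: cvg_at_right_filter; exact: CF.
    + by apply: cvg_at_left_filter; exact: CF.
  - move=> t; rewrite in_itv/= => /andP[et _].
    by have H := DF t (lt_trans (e0 n) et); rewrite derive1E derive_val.
rewrite -(@integral_itv_bndoo _ 0 1 _ false false); last first.
  by apply/measurable_EFinP; exact: measurable_itvoo01.
have U : `]0, 1]%classic = \bigcup_n `[e n, 1]%classic :> set R.
  apply/seteqP; split => t /=; rewrite in_itv/=.
    move=> /andP[t0 t1].
    have /cvgrPdist_lt /(_ _ t0) [N _ HN] := @cvgn_expR R.
    exists N => //=; rewrite in_itv/= t1 andbT.
    have := HN N.+1 (leqnSn N); rewrite sub0r normrN ger0_norm ?expR_ge0//.
    exact: ltW.
  move=> [n _]; rewrite /= in_itv/= => /andP[et ->]; rewrite andbT.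
  exact: lt_le_trans et.
have e_dec m n : (m <= n)%N -> e n <= e m by move=> mn; rewrite ler_expR lerN2 ler_nat.
have L1 : (\int[mu]_(t in `[e n, 1%R]) (f t)%:E)%E @[n --> \oo] --> (\int[mu]_(t in `]0%R, 1%R]) (f t)%:E)%E.
  rewrite U; apply: ge0_nondecreasing_set_cvg_integral.
  - move=> m n mn; rewrite subsetEset => t; rewrite /= !in_itv/= => /andP[et ->].
    by rewrite andbT (le_trans (e_dec _ _ mn)).
  - by move=> n; exact: measurable_itv.
  - move=> n; apply/measurable_EFinP; apply: subspace_continuous_measurable_fun => //.
    apply: continuous_in_subspaceT => t; rewrite inE/= in_itv/= => /andP[et _].
    exact/Cf/lt_le_trans/et.
  - move=> n t /=; rewrite in_itv/= => /andP[et t1]; rewrite lee_fin f0// t1 andbT.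
    exact: lt_le_trans et.
apply: (cvg_unique _ L1) => //=.
rewrite (_ : (fun n => _) = (fun n => (F 1 - F (e n))%:E)); last first.
  by apply/funext => n; rewrite Ie.
apply: cvg_EFin; first exact: nearW.
rewrite -[X in _ --> X]subr0; apply: cvgB; first exact: cvg_cst.
by move: F0; rewrite -cvg_shiftS.
Qed.

(* [t = tan (theta / 2)] turns [tan_u t] into [sin theta]. *)
Definition tan_u (t : R) : R := 2 * t / (1 + t ^+ 2).

Definition tan_du (t : R) : R := 2 * (1 - t ^+ 2) / (1 + t ^+ 2) ^+ 2.

(** For [t > 0] this is [- ln (tan_u t)]. *)
Definition log_u (t : R) : R := ln ((1 + t ^+ 2) / (2 * t)).

Lemma onePsqr_neq0 (t : R) : 1 + t ^+ 2 != 0.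
Proof. by rewrite gt_eqF// ltr_wpDr// sqr_ge0. Qed.

Lemma is_derive_onePsqr (t : R) : is_derive t 1 (fun x => 1 + x ^+ 2) (2 * t).
Proof.
apply: (is_derive_eq (is_derive_addf (is_derive_cst (1 : R) _ _) (is_derive_expf 2 (is_derive_id _ _)))).
by rewrite /=; ring.
Qed.

Lemma is_derive_2id (t : R) : is_derive t 1 (fun x => 2 * x) 2.
Proof.
apply: (is_derive_eq (is_derive_mulf (is_derive_cst (2 : R) _ _) (is_derive_id _ _))).
by rewrite /=; ring.
Qed.

Lemma is_derive_tan_u (t : R) : is_derive t 1 tan_u (tan_du t).
Proof.
have t2 := onePsqr_neq0 t.
apply: (is_derive_eq (is_derive_mulf (is_derive_2id t)
  (@is_derive_invf _ (fun x => 1 + x ^+ 2) _ _ t2 (is_derive_onePsqr t)))).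
by rewrite /tan_du; field.
Qed.

Lemma is_derive_log_u (t : R) : 0 < t -> is_derive t 1 log_u (- tan_du t / tan_u t).
Proof.
move=> t0; have t2 := onePsqr_neq0 t; have tn0 : t != 0 by rewrite gt_eqF.
have tt0 : 2 * t != 0 by rewrite mulf_neq0.
have q0 : 0 < (1 + t ^+ 2) / (2 * t).
  by rewrite divr_gt0// ?mulr_gt0// ltr_wpDr// sqr_ge0.
apply: (is_derive_eq (is_derive_compf (is_derive_mulf (is_derive_onePsqr t)
  (@is_derive_invf _ (fun x => 2 * x) _ _ tt0 (is_derive_2id t))) (is_derive1_ln q0))).
by rewrite /tan_du /tan_u; field; rewrite t2 tn0.
Qed.

Lemma tan_u_gt0 (t : R) : 0 < t -> 0 < tan_u t.
Proof. by move=> t0; rewrite divr_gt0// ?mulr_gt0// ltr_wpDr// sqr_ge0. Qed.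

Lemma log_u_ge0 (t : R) : 0 < t -> 0 <= log_u t.
Proof.
move=> t0; apply: ln_ge0; rewrite ler_pdivlMr ?mulr_gt0// mul1r -subr_ge0.
have -> : 1 + t ^+ 2 - 2 * t = (1 - t) ^+ 2 by ring.
exact: sqr_ge0.
Qed.

Lemma tan_du_ge0 (t : R) : 0 < t <= 1 -> 0 <= tan_du t.
Proof.
move=> /andP[t0 t1]; rewrite divr_ge0 ?sqr_ge0// mulr_ge0// subr_ge0 exprn_ile1//.
exact: ltW.
Qed.

(** The form [u ^ m * (- ln u) ^ k / k! du] pulled back along [u = tan_u t]; staying in the variable
    [t] avoids a change of variables under the integral. *)
Definition log_moment_density (k m : nat) (t : R) : R :=
  tan_u t ^+ m * tan_du t * (log_u t ^+ k / k`!%:R).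

(** Integration by parts: [u ^ m] is integrated and [(- ln u) ^ k / k!] differentiated, which lowers
    [k] by one. *)
Fixpoint log_moment_primitive (k m : nat) (t : R) : R :=
  if k is k'.+1 then
    (log_moment_primitive k' m t + tan_u t ^+ m.+1 * (log_u t ^+ k / k`!%:R)) / m.+1%:R
  else tan_u t ^+ m.+1 / m.+1%:R.

Lemma is_derive_log_moment_primitive k m (t : R) : 0 < t ->
  is_derive t 1 (log_moment_primitive k m) (log_moment_density k m t).
Proof.
move=> t0; have m0 : m.+1%:R != 0 :> R by rewrite pnatr_eq0.
have u0 : tan_u t != 0 by rewrite gt_eqF// tan_u_gt0.
have Du := is_derive_expf m.+1 (is_derive_tan_u t).
elim: k => [|k IH] /=.
  apply: (is_derive_eq (is_derive_mulf Du (is_derive_cst (m.+1%:R^-1 : R) _ _))).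
  by rewrite /log_moment_density /= fact0 expr0; field.
have k0 : k.+1%:R != 0 :> R by rewrite pnatr_eq0.
have f0 : k`!%:R != 0 :> R by rewrite pnatr_eq0 -lt0n fact_gt0.
apply: (is_derive_eq (is_derive_mulf (is_derive_addf IH (is_derive_mulf Du
  (is_derive_mulf (is_derive_expf k.+1 (is_derive_log_u t0)) (is_derive_cst (k.+1`!%:R^-1 : R) _ _))))
  (is_derive_cst (m.+1%:R^-1 : R) _ _))).
rewrite /log_moment_density /= factS natrM exprS [log_u t ^+ k.+1]exprS.
move: (k.+1%:R) (m.+1%:R) k0 m0 => x y x0 y0.
by field; rewrite ?u0 ?x0 ?y0 ?f0.
Qed.

Lemma log_moment_density_continuous k m (t : R) : 0 < t ->
  {for t, continuous (log_moment_density k m)}.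
Proof.
move=> t0; apply: differentiable_continuous; apply/derivable1_diffP.
have t2 := onePsqr_neq0 t.
have D1 := is_derive_mulf (is_derive_mulf (is_derive_cst (2 : R) _ _)
  (is_deriveB (is_derive_cst (1 : R) _ _) (is_derive_expf 2 (is_derive_id t (1 : R)))))
  (@is_derive_invf _ (fun x => (1 + x ^+ 2) ^+ 2) _ _ (expf_neq0 2 t2) (is_derive_expf 2 (is_derive_onePsqr t))).
have [] := is_derive_mulf (is_derive_mulf (is_derive_expf m (is_derive_tan_u t)) D1)
  (is_derive_mulf (is_derive_expf k (is_derive_log_u t0)) (is_derive_cst (k`!%:R^-1 : R) _ _)).
by [].
Qed.

Lemma log_moment_density_ge0 k m (t : R) : 0 < t <= 1 -> 0 <= log_moment_density k m t.
Proof.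
move=> t01; have /andP[t0 _] := t01.
apply: mulr_ge0; last by rewrite divr_ge0// exprn_ge0// log_u_ge0.
by apply: mulr_ge0; [exact/exprn_ge0/ltW/tan_u_gt0 | exact: tan_du_ge0].
Qed.

(** At [t = 1] the logarithm vanishes, so each level of the recursion only divides by [m.+1]. *)
Lemma log_moment_primitive1 k m : log_moment_primitive k m 1 = (m.+1%:R ^+ k.+1)^-1.
Proof.
have u1 : tan_u 1 = 1 by rewrite /tan_u expr1n mulr1 divff// onePsqr_neq0.
have l1 : log_u 1 = 0 by rewrite /log_u expr1n mulr1 divff ?ln1.
elim: k => [|k IH] /=; first by rewrite u1 expr1n div1r.
by rewrite IH l1 expr0n /= mul0r mulr0 addr0 [in RHS]exprSr invfM mulrC.
Qed.

(** With [N = n.+1] and [t = expR (- N)], the bounds [tan_u t <= 2 t], [log_u t <= N] and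
    [N ^ (k + 1) / (k + 1)! <= expR N] leave at most [2 (k + 1) / N]. *)
Lemma tan_u_log_u_cvg0 k m :
  tan_u (expR (- n%:R)) ^+ m.+1 * (log_u (expR (- n%:R)) ^+ k / k`!%:R) @[n --> \oo] --> 0.
Proof.
rewrite -cvg_shiftS.
have H0 : 2 * k.+1%:R * harmonic n @[n --> \oo] --> (0 : R).
  by have := @cvg_harmonic R => /(cvgMl_tmp (a := 2 * k.+1%:R)); rewrite mulr0.
refine (@squeeze_cvgr _ _ _ R (cst 0) (fun n => 2 * k.+1%:R * harmonic n) _ _ 0 (cvg_cst _) H0).
apply: nearW => n /=; set t := expR _.
have t0 : 0 < t by exact: expR_gt0.
have t1 : t <= 1 by rewrite expR_le1 oppr_le0.
have u0 := tan_u_gt0 t0; have l0 := log_u_ge0 t0.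
have n0 : 0 < n.+1%:R :> R by [].
have t20 : 0 < 1 + t ^+ 2 by rewrite ltr_wpDr// sqr_ge0.
have kf m' : 0 < m'`!%:R :> R by rewrite ltr0n fact_gt0.
apply/andP; split; first by rewrite mulr_ge0 ?divr_ge0 ?exprn_ge0// ltW.
have u2 : tan_u t <= 2 * t.
  by rewrite ler_pdivrMr// ler_peMr ?lerDl ?sqr_ge0// mulr_ge0// ltW.
have u1 : tan_u t <= 1.
  rewrite ler_pdivrMr// mul1r -subr_ge0.
  have -> : 1 + t ^+ 2 - 2 * t = (1 - t) ^+ 2 by ring.
  exact: sqr_ge0.
(* Because [t <= 1], the argument of the logarithm is at most [1 / t = expR n.+1]. *)
have ln1 : log_u t <= n.+1%:R.
  rewrite -[leRHS]expRK ler_ln ?posrE ?expR_gt0 ?divr_gt0 ?mulr_gt0//.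
  rewrite -[n.+1%:R]opprK expRN -/t ler_pdivrMr ?mulr_gt0// mulrCA mulVf ?gt_eqF// mulr1.
  have t2 : t ^+ 2 <= 1 by rewrite exprn_ile1// ltW.
  lra.
have um : tan_u t ^+ m.+1 <= 2 * t.
  by rewrite exprS; apply: le_trans u2; rewrite ler_piMr ?exprn_ile1// ltW.
have et : n.+1%:R ^+ k.+1 / k.+1`!%:R <= t^-1.
  rewrite -expRN opprK; apply: le_trans (expR_ge1Dxn k (ltW n0)).
  by rewrite lerDr.
apply: (@le_trans _ _ (2 * t * (n.+1%:R ^+ k / k`!%:R))).
  apply: ler_pM => //; first by rewrite exprn_ge0// ltW.
    by rewrite divr_ge0// exprn_ge0.
  by rewrite ler_wpM2r ?invr_ge0// lerXn2r ?nnegrE.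
rewrite /GRing.scale/= -!mulrA ler_pM2l//.
rewrite /harmonic ler_pdivlMr//.
have -> : t * (n.+1%:R ^+ k / k`!%:R) * n.+1%:R = t * n.+1%:R ^+ k.+1 / k`!%:R.
  by rewrite exprSr !mulrA mulrAC.
rewrite ler_pdivrMr// -natrM -factS -ler_pdivlMl//.
by rewrite -ler_pdivrMr//.
Qed.

Lemma log_moment_primitive_cvg0 k m :
  log_moment_primitive k m (expR (- n%:R)) @[n --> \oo] --> 0.
Proof.
elim: k => [|k IH] /=; rewrite -[X in _ --> X](mul0r (m.+1%:R^-1 : R)); apply: cvgMr_tmp.
  have := tan_u_log_u_cvg0 0 m; apply: cvg_trans; apply: near_eq_cvg; apply: nearW => n.
  by rewrite fact0 expr0 divr1 mulr1.
by rewrite -[X in _ --> X](addr0 (0 : R)); apply: cvgD IH (tan_u_log_u_cvg0 k.+1 m).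
Qed.

Lemma integral_log_moment k m :
  (\int[mu]_(t in `]0%R, 1%R[) (log_moment_density k m t)%:E = ((m.+1%:R ^+ k.+1)^-1)%:E)%E.
Proof.
rewrite -(log_moment_primitive1 k m); apply: integral_itvoo_FTC.
- exact: is_derive_log_moment_primitive.
- exact: log_moment_density_continuous.
- exact: log_moment_density_ge0.
- exact: log_moment_primitive_cvg0.
Qed.

End LogMoments.

(** * Integration term by term *)

Section MainTheorem.
Context {R : realType}.
Local Notation mu := (@lebesgue_measure R).

Lemma TiE m (t : R) : 0 <= t < 1 -> Ti m t = t * psum (Ti_coef m) (t ^+ 2).
Proof.
move=> /andP[t0 t1]; rewrite /Ti; apply/cvg_lim => //; rewrite -cvg_shiftS /=.
have -> : (fun n => \sum_(1 <= i < n.+1)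
      ((-1) ^+ (i - 1) * t ^+ (2 * i - 1) / (2 * i - 1)%:R ^+ m)) =
    t \*: pseries (Ti_coef m) (t ^+ 2).
  apply/funext => n; rewrite big_add1 /pseries /series /= scaler_sumr.
  apply: eq_bigr => i _; rewrite /GRing.scale/= /Ti_coef.
  have -> : (2 * i.+1 - 1 = 2 * i + 1)%N by lia.
  by rewrite subSS subn0 exprD exprM expr1 mulrA [RHS]mulrC; ring.
apply: cvgZl_tmp; apply: is_cvg_psum; first exact: unit_radius_Ti.
by rewrite ger0_norm ?exprn_ge0// exprn_ilt1.
Qed.

Lemma nneseries_EFin (r : R^nat) (l : R) : series r @ \oo --> l ->
  (\sum_(0 <= n <oo) (r n)%:E = l%:E)%E.
Proof.
move=> rl; apply/cvg_lim => //; under eq_fun do rewrite sumEFin.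
by apply: cvg_EFin; [exact: nearW | exact: rl].
Qed.

(** The Jacobian [tan_du t] is twice the prefactor in [psum_star_Ti] at [v = t ^ 2]; this is the
    source of the 2 in the result. *)
Lemma star_density_sum j k (t : R) : 0 < t < 1 ->
  (\sum_(0 <= n <oo) (star_coef j n * log_moment_density k (2 * n) t)%:E =
   (2 / k`!%:R * (log_u t ^+ k * Ti (2 * j + 1) t / t))%:E)%E.
Proof.
move=> /andP[t0 t1]; have t20 : 0 <= t ^+ 2 < 1 by rewrite sqr_ge0 exprn_ilt1// ltW.
have tn0 : t != 0 by rewrite gt_eqF.
have fn0 : k`!%:R != 0 :> R by rewrite pnatr_eq0 -lt0n fact_gt0.
have wE : tan_u t ^+ 2 = 4 * t ^+ 2 / (1 + t ^+ 2) ^+ 2.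
  by rewrite /tan_u; field; exact: onePsqr_neq0.
apply: nneseries_EFin.
have -> : 2 / k`!%:R * (log_u t ^+ k * Ti (2 * j + 1) t / t) =
    tan_du t * (log_u t ^+ k / k`!%:R) * psum (star_coef j) (tan_u t ^+ 2).
  rewrite TiE ?t1 ?ltW// -psum_star_Ti// -wE /tan_du; field.
  by rewrite onePsqr_neq0 fn0 tn0.
have -> : series (fun n => star_coef j n * log_moment_density k (2 * n) t) =
    (tan_du t * (log_u t ^+ k / k`!%:R)) \*: pseries (star_coef j) (tan_u t ^+ 2).
  apply/funext => n; rewrite /pseries /series /= scaler_sumr.
  apply: eq_bigr => i _; rewrite /GRing.scale/= /log_moment_density exprM; ring.
apply: cvgZl_tmp; apply: is_cvg_psum; first exact: unit_radius_star.
have u1 : tan_u t < 1.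
  rewrite /tan_u ltr_pdivrMr; last by rewrite ltr_wpDr// sqr_ge0.
  rewrite mul1r -subr_gt0 (_ : _ - _ = (1 - t) ^+ 2); last by ring.
  by rewrite exprn_gt0// subr_gt0.
by rewrite ger0_norm ?sqr_ge0// exprn_ilt1// ltW// tan_u_gt0.
Qed.

(** The terms are nonnegative and at most [2 ^ j * central_coef n / (2 n + 1)], whose partial sums
    are bounded by telescoping. *)
Lemma is_cvg_star_series j k :
  cvgn (series (fun n => star_coef j n / (2 * n + 1)%:R ^+ k.+1 : R)).
Proof.
have x0 n : 0 < (2 * n + 1)%:R :> R by rewrite ltr0n addn1.
have c0 n : 0 <= star_coef j n / (2 * n + 1)%:R ^+ k.+1 :> R.
  by rewrite divr_ge0 ?exprn_ge0 ?star_coef_ge0.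
have S n : series (fun n => central_coef n / (2 * n + 1)%:R : R) n.+1 <= 2 - central_coef n.
  elim: n => [|n IH].
    by rewrite /series /= big_nat1 central_coef0 divr1; lra.
  rewrite seriesSr; apply: (le_trans (lerD IH (lexx _))).
  rewrite -addrA lerD2l -subr_ge0.
  have -> : - central_coef n.+1 - (- central_coef n + central_coef n.+1 / (2 * n.+1 + 1)%:R) =
      (central_coef n - central_coef n.+1) - central_coef n.+1 / (2 * n.+1 + 1)%:R :> R by ring.
  rewrite central_coef_diff subr_ge0 ler_wpM2l ?central_coef_ge0// lef_pV2 ?posrE//.
  by rewrite ler_nat leq_addr.
apply: nondecreasing_is_cvgn.
  by apply/nondecreasing_seqP => n; rewrite seriesSr lerDl.
exists (2 ^+ j * 2) => _ [n _ <-].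
apply: (@le_trans _ _ (2 ^+ j * series (fun n => central_coef n / (2 * n + 1)%:R : R) n.+1)).
  rewrite /series /= mulr_sumr [leRHS]big_nat_recr //= -[leLHS]addr0; apply: lerD.
    apply: ler_sum => i _; rewrite /star_coef mulrA [2 ^+ j * _]mulrC.
    apply: ler_pM; rewrite ?invr_ge0 ?exprn_ge0 ?mulr_ge0 ?central_coef_ge0 ?odd_sum_ge0//.
      by rewrite ler_wpM2l ?central_coef_ge0 ?odd_sum_le.
    by rewrite lef_pV2 ?posrE ?exprn_gt0// ler_eXnr// ler1n addn1.
  by rewrite mulr_ge0 ?exprn_ge0// divr_ge0// central_coef_ge0.
rewrite ler_pM2l ?exprn_gt0//; apply: le_trans (S n) _.
by rewrite gerBl central_coef_ge0.
Qed.

Lemma star_term_ge0 j k n (t : R) : 0 < t < 1 ->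
  0 <= star_coef j n * log_moment_density k (2 * n) t.
Proof.
move=> /andP[t0 t1]; rewrite mulr_ge0 ?star_coef_ge0// log_moment_density_ge0//.
by rewrite t0 ltW.
Qed.

Lemma measurable_star_term j k n :
  measurable_fun (`]0, 1[%classic : set R)
    (fun t => (star_coef j n * log_moment_density k (2 * n) t)%:E).
Proof.
apply/measurable_EFinP; apply: measurable_funM; first exact: measurable_cst.
by apply: measurable_itvoo01 => t; exact: log_moment_density_continuous.
Qed.

Lemma integral_star_term j k n :
  (\int[mu]_(t in `]0%R, 1%R[) (star_coef j n * log_moment_density k (2 * n) t)%:E =
   (star_coef j n / (2 * n + 1)%:R ^+ k.+1)%:E)%E.
Proof.
under eq_integral do rewrite EFinM.
rewrite ge0_integralZl_EFin ?star_coef_ge0//.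
- by rewrite integral_log_moment addn1 -EFinM.
- move=> t /=; rewrite in_itv/= => /andP[t0 t1].
  by rewrite lee_fin log_moment_density_ge0// t0 ltW.
- apply/measurable_EFinP; apply: measurable_itvoo01 => t.
  exact: log_moment_density_continuous.
Qed.

(** Sum and integral are exchanged by nonnegativity alone; finiteness comes from the convergence of
    the resulting numerical series. *)
Lemma integral_star j k :
  (\int[mu]_(t in `]0%R, 1%R[) (2 / k`!%:R * (log_u t ^+ k * Ti (2 * j + 1) t / t))%:E =
   (limn (series (fun n => star_coef j n / (2 * n + 1)%:R ^+ k.+1)))%:E)%E.
Proof.
rewrite -(nneseries_EFin (@is_cvg_star_series j k)).
under [RHS]eq_eseriesr do rewrite -integral_star_term.
rewrite -integral_nneseries//.
- by apply: eq_integral => t; rewrite inE/= in_itv/= => t01; rewrite star_density_sum.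
- by move=> n; exact: measurable_star_term.
- by move=> n t; rewrite /= in_itv/= => t01; rewrite lee_fin star_term_ge0.
Qed.

(** On the open interval the integrand is a series of nonnegative measurable functions, so nothing
    about the continuity of [Ti] has to be proved. *)
Lemma measurable_star j k :
  measurable_fun (`]0, 1[%classic : set R)
    (fun t => 2 / k`!%:R * (log_u t ^+ k * Ti (2 * j + 1) t / t)).
Proof.
apply/measurable_EFinP; apply: (@eq_measurable_fun _ _ _ _ _
  (fun t => (\sum_(0 <= n <oo) (star_coef j n * log_moment_density k (2 * n) t)%:E)%E)).
  by move=> t; rewrite inE/= in_itv/= => t01; rewrite star_density_sum.
apply: ge0_emeasurable_sum => [n t|n _].
  by rewrite /= in_itv/= => t01 _; rewrite lee_fin star_term_ge0.
exact: measurable_star_term.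
Qed.

Lemma star_ge0 j k (t : R) : 0 < t < 1 ->
  0 <= 2 / k`!%:R * (log_u t ^+ k * Ti (2 * j + 1) t / t).
Proof.
move=> t01; rewrite -lee_fin -star_density_sum//; apply: nneseries_ge0 => n _ _.
by rewrite lee_fin star_term_ge0.
Qed.

Lemma integrable_star j k : mu.-integrable `[0, 1]
  (fun t => (2 / k`!%:R * (log_u t ^+ k * Ti (2 * j + 1) t / t))%:E).
Proof.
have ms := @measurable_star j k.
apply/integrableP; split.
  apply/measurable_EFinP.
  (* The expansion covers only the open interval; at the endpoints any values are measurable,
     including the default ones at [t = 0]. *)
  have -> : `[0, 1]%classic = [set 0] `|` `]0, 1[ `|` [set 1] :> set R.
    by rewrite setU1itv ?bnd_simp// setUitv1// bnd_simp.
  apply/measurable_funU => //; first exact: measurableU.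
  split; last exact: measurable_fun_set1.
  by apply/measurable_funU => //; split => //; exact: measurable_fun_set1.
rewrite (@integral_itv_bndoo _ 0 1 _ true false); last first.
  by apply: measurableT_comp => //; exact/measurable_EFinP.
rewrite (_ : (\int[mu]_(_ in _) _)%E = (limn (series (fun n => star_coef j n / (2 * n + 1)%:R ^+ k.+1)))%:E) ?ltry//.
rewrite -integral_star; apply: eq_integral => t; rewrite inE/= in_itv/= => t01.
by rewrite ger0_norm// star_ge0.
Qed.

Lemma Rintegral_star j k :
  \int[mu]_(t in `[0, 1]) (2 / k`!%:R * (log_u t ^+ k * Ti (2 * j + 1) t / t)) =
  limn (series (fun n => star_coef j n / (2 * n + 1)%:R ^+ k.+1)).
Proof.
rewrite /Rintegral (@integral_itv_bndoo _ 0 1 _ true false) ?integral_star//.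
by apply/measurable_EFinP; exact: measurable_star.
Qed.

End MainTheorem.

Theorem theorem3p9 (R : realType) (j k : nat) (hk : (0 < k)%N) :
  let mu := @lebesgue_measure R in
  let a (n : nat) : R :=
    4 ^+ n / ((2 * n + 1)%:R ^+ (k + 1) * 'C(2 * n, n)%:R) * t_star R (n + 1) j in
  let f (t : R) : R :=
    ln ((1 + t ^+ 2) / (2 * t)) ^+ (k - 1) * Ti (2 * j + 1) t / t in
  [/\ cvgn (series a),
      mu.-integrable `[0, 1] (EFin \o f) &
      \big[+%R/0]_(0 <= n <oo) a n
        = 2 / ((k - 1)`!)%:R * \int[mu]_(t in `[0, 1]) f t].
Proof.
case: k hk => // k _ mu a f; rewrite subn1 /= in f *.
(* Here [k] already stands for the former [k - 1], so the exponent is [k.+2]; one factor [2 n + 1]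
   goes into [central_coef]. *)
have aE : a = fun n => star_coef j n / (2 * n + 1)%:R ^+ k.+1.
  apply/funext => n; rewrite /a t_starE /star_coef /central_coef (addn1 n) (addn1 k.+1).
  by rewrite [_ ^+ k.+2]exprS !invfM; ring.
have fn0 : k`!%:R != 0 :> R by rewrite pnatr_eq0 -lt0n fact_gt0.
pose c : R := 2 / k`!%:R.
have c0 : c != 0 by rewrite mulf_neq0// invr_eq0.
have If : mu.-integrable `[0, 1] (EFin \o f).
  (* Integrability was established for [c * f], hence the division by [c]. *)
  rewrite (_ : EFin \o f = (fun t => c^-1%:E * (c * f t)%:E)%E); last first.
    by apply/funext => t; rewrite -EFinM mulKf.
  by apply: integrableZl; [exact: measurable_itv | exact: integrable_star].
split => //; first by rewrite aE; exact: is_cvg_star_series.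
rewrite -RintegralZl//= Rintegral_star aE.
by [].
Qed.
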